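(* Let $M=\bigoplus_{i=1}^r I_ie_i\subsetneq S^r$, $r\ge1$, be a squarefree stable submodule generated in degrees $1\le d_1<d_2<\dots<d_t\le n$ (that is, these are exactly the degrees of its minimal monomial generators). For $j=1,\dots,t$ set $m_{d_j}=\max\{\mathrm{m}(u) : ue_i\in G(M)_{d_j},\ i=1,\dots,r\}$, and call $(m_{d_1}-d_1,\,m_{d_2}-d_2,\dots,m_{d_t}-d_t)$ the degree-sequence of $M$. Suppose that the chain of inequalities $m_{d_1}-d_1>m_{d_2}-d_2>\dots>m_{d_t}-d_t$ does not hold. Construct a subsequence $$(m_{d_{i_1}}-d_{i_1},\ m_{d_{i_2}}-d_{i_2},\ \dots,\ m_{d_{i_q}}-d_{i_q}),\qquad d_1\le d_{i_1}<d_{i_2}<\dots<d_{i_q}=d_t,$$ of the degree-sequence as follows: $d_{i_1}$ is the smallest degree of a monomial generator of $M$ such that $m_{d_{i_1}}-d_{i_1}>m_{d_j}-d_j$ for all $j>i_1$; $d_{i_2}>d_{i_1}$ is the smallest degree of a monomial generator of $M$ (among those greater than $d_{i_1}$) such that $m_{d_{i_2}}-d_{i_2}>m_{d_j}-d_j$ for all $j>i_2$; and so on, up to $d_{i_{q-1}}>d_{i_{q-2}}$, the smallest degree of a monomial generator of $M$ (among those greater than $d_{i_{q-2}}$) such that $m_{d_{i_{q-1}}}-d_{i_{q-1}}>m_{d_j}-d_j$ for all $j>i_{q-1}$; finally $d_{i_q}=d_t$. Then $$m_{d_{i_1}}-d_{i_1}>m_{d_{i_2}}-d_{i_2}>\dots>m_{d_{i_q}}-d_{i_q},$$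 the Betti numbers $$\beta_{m_{d_{i_1}}-d_{i_1},\,m_{d_{i_1}}}(M),\ \beta_{m_{d_{i_2}}-d_{i_2},\,m_{d_{i_2}}}(M),\ \dots,\ \beta_{m_{d_{i_q}}-d_{i_q},\,m_{d_{i_q}}}(M)$$ are extremal Betti numbers of $M$, and the integer $q$ (called the degree-length of $M$) gives the number of the extremal Betti numbers of $M$.
   Context: $K$ is a field, $S=K[x_1,\dots,x_n]$ with $\deg x_i=1$, and $S^r=\bigoplus_{i=1}^rSe_i$ is graded with all $e_i$ in degree $0$, so $\deg(ue_i)=\deg u$ for a monomial $u\in S$. For a monomial $u\ne 1$ of $S$, $\mathrm{supp}(u)=\{i : x_i\mid u\}$ and $\mathrm{m}(u)=\max \mathrm{supp}(u)$. For a monomial ideal $I\subsetneq S$, $G(I)$ denotes its minimal set of monomial generators. A squarefree monomial ideal $I\subsetneq S$ is a squarefree stable ideal if for all $u\in G(I)$ one has $x_ju/x_{\mathrm{m}(u)}\in I$ for all $j<\mathrm{m}(u)$, $j\notin\mathrm{supp}(u)$. A graded submodule $M$ of $S^r$ is a squarefree stable submodule if $M=\bigoplus_{i=1}^r I_ie_i$ with each $I_i\subsetneq S$ a squarefree stable ideal and $I_r\subseteq I_{r-1}\subseteq\dots\subseteq I_1$. $G(M)=\{ue_i : u\in G(I_i),\ i=1,\dots,r\}$ and $G(M)_d=\{ue_i\in G(M) : \deg u=d\}$. $\beta_{i,j}(M)=\dim_K\mathrm{Tor}_i^S(K,M)_j$ are the graded Betti numbers. A Betti number $\beta_{k,k+\ell}(M)\neq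 0$ is extremal if $\beta_{i,i+j}(M)=0$ for all $i\ge k$, $j\ge\ell$, $(i,j)\ne(k,\ell)$. *)

(* Defs.v *)
From Stdlib Require Import ClassicalEpsilon.
From mathcomp Require Import all_boot all_order all_algebra.
From mathcomp Require Export mpoly.

Set Implicit Arguments.
Unset Strict Implicit.
Unset Printing Implicit Defensive.

Import GRing.Theory.
Local Open Scope ring_scope.

Section Monomials.
Variable n : nat.
Implicit Types u : 'X_{1..n}.

(* The variables are 'X_i with i : 'I_n numbered from 0, whence the shift:
   max_var u is the 1-based index of the last variable dividing u.  It is 0
   for u = 1, where the notion is not used. *)
Definition max_var u : nat := \max_(i < n | u i != 0%N) i.+1.

Definition squarefree u : Prop := forall i : 'I_n, (u i <= 1)%N.

End Monomials.

Section Ideals.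
Variables (K : fieldType) (n : nat).
Local Notation S := {mpoly K[n]}.
Implicit Types (A B : 'X_{1..n} -> Prop) (I : S -> Prop).

(* Membership in the ideal generated by the monomials in A. *)
Definition in_span A (p : S) : Prop :=
  exists2 s : seq (S * 'X_{1..n}),
    (forall x, x \in s -> A x.2) & p = \sum_(x <- s) x.1 * 'X_[x.2].

Definition generates A I : Prop := forall p, I p <-> in_span A p.

Definition minimally_generates A I : Prop :=
  generates A I /\
  forall B, (forall u, B u -> A u) -> generates B I -> forall u, A u -> B u.

(* G(I) *)
Definition min_gen I (u : 'X_{1..n}) : Prop :=
  exists2 A, minimally_generates A I & A u.

Definition squarefree_monomial_ideal I : Prop :=
  exists2 A, (forall u, A u -> squarefree u) & generates A I.

(* The hypothesis i.+1 = max_var u says that 'X_i is the last variable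
   dividing u; subtraction of multinomials is then exact. *)
Definition squarefree_stable_ideal I : Prop :=
  [/\ squarefree_monomial_ideal I,
      exists p, ~ I p
    & forall u, min_gen I u ->
      forall i j : 'I_n, i.+1 = max_var u -> (j < i)%N -> u j = 0%N ->
      I 'X_[u - U_(i) + U_(j)]].

End Ideals.

Section Submodules.
Variables (K : fieldType) (n r : nat).
Local Notation S := {mpoly K[n]}.

(* The submodule I_1 e_1 + ... + I_r e_r of S^r. *)
Definition direct_sum (I : 'I_r -> S -> Prop) (x : 'rV[S]_r) : Prop :=
  forall k, I k (x 0 k).

Definition squarefree_stable_submodule (I : 'I_r -> S -> Prop) : Prop :=
  (forall k, squarefree_stable_ideal (I k)) /\
  (forall k l : 'I_r, (k <= l)%N -> forall p, I l p -> I k p).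

(* A sequence ... -> F_2 -> F_1 -> F_0 -> S^r of finitely generated graded
   free modules: F_i has rank crank i, its a-th basis element has degree
   cdeg i a, and the maps act on row vectors by right multiplication by the
   matrices cdiff i : F_(i+1) -> F_i and caug : F_0 -> S^r. *)
Record free_complex := FreeComplex {
  crank : nat -> nat;
  cdeg : forall i, 'I_(crank i) -> nat;
  cdiff : forall i, 'M[S]_(crank i.+1, crank i);
  caug : 'M[S]_(crank 0, r) }.

Definition zero_complex : free_complex :=
  @FreeComplex (fun=> 0%N) (fun _ _ => 0%N) (fun=> 0) 0.

Section Homology.
Variable F : free_complex.

(* The maps are homogeneous of degree 0. *)
Definition homogeneous_complex : Prop :=
  (forall i (a : 'I_(crank F i.+1)) (c : 'I_(crank F i)) u,
     u \in msupp (cdiff F i a c) -> (mdeg u + cdeg c)%N = cdeg a) /\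
  (forall (a : 'I_(crank F 0)) k u, u \in msupp (caug F a k) -> mdeg u = cdeg a).

Definition graded_free_resolution (M : 'rV[S]_r -> Prop) : Prop :=
  [/\ homogeneous_complex,
      forall x, M x <-> exists v, x = v *m caug F,
      forall v : 'rV_(crank F 0), v *m caug F = 0 <-> exists w, v = w *m cdiff F 0
    & forall i (v : 'rV_(crank F i.+1)),
        v *m cdiff F i = 0 <-> exists w, v = w *m cdiff F i.+1].

(* K (x)_S F: since K = S/(x_1,...,x_n), tensoring replaces every matrix
   entry by its constant term. *)
Definition tdiff i : 'M[K]_(crank F i.+1, crank F i) :=
  map_mx (mcoeff 0%MM) (cdiff F i).

(* Its row space is the degree j part of K (x)_S F_i. *)
Definition tpart i (j : nat) : 'M[K]_(crank F i) :=
  diag_mx (\row_a (cdeg a == j)%:R).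

Definition tcycles i (j : nat) : 'M[K]_(crank F i) :=
  match i with
  | 0 => tpart 0 j
  | i'.+1 => (tpart i'.+1 j :&: kermx (tdiff i'))%MS
  end.

Definition tboundaries i (j : nat) : 'M[K]_(crank F i.+1, crank F i) :=
  tpart i.+1 j *m tdiff i.

(* dim_K H_i(K (x)_S F)_j; the boundaries are contained in the cycles when F
   is a complex, so the subtraction is not truncated. *)
Definition tor_dim i (j : nat) : nat := (\rank (tcycles i j) - \rank (tboundaries i j))%N.

End Homology.

(* dim_K Tor_i^S(K, M)_j, computed from some graded free resolution of M. *)
Definition betti (M : 'rV[S]_r -> Prop) (i j : nat) : nat :=
  tor_dim
    (epsilon (inhabits zero_complex) (fun F => graded_free_resolution F M)) i j.

(* beta_{k,kl}(M) is an extremal Betti number; here kl = k + l. *)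
Definition extremal_betti (M : 'rV[S]_r -> Prop) (k kl : nat) : Prop :=
  exists l, [/\ kl = (k + l)%N, betti M k (k + l) <> 0%N
    & forall i j, (k <= i)%N -> (l <= j)%N -> (i, j) <> (k, l) ->
      betti M i (i + j) = 0%N].

(* d enumerates increasingly the degrees of the elements of G(M). *)
Definition generated_in_degrees (I : 'I_r -> S -> Prop) t (d : 'I_t -> nat) :=
  [/\ forall j, (1 <= d j <= n)%N,
      forall j j' : 'I_t, (j < j')%N -> (d j < d j')%N
    & forall e, (exists j, d j = e) <->
                (exists k u, min_gen (I k) u /\ mdeg u = e)].

(* m j = max {m(u) : u e_k in G(M), deg u = d j} *)
Definition max_var_in_degrees (I : 'I_r -> S -> Prop) t (d m : 'I_t -> nat) :=
  forall j,
    (exists k u, [/\ min_gen (I k) u, mdeg u = d j & max_var u = m j]) /\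
    (forall k u, min_gen (I k) u -> mdeg u = d j -> (max_var u <= m j)%N).

End Submodules.

Section Subsequence.
Variables (t : nat) (a : 'I_t -> nat).

Definition exceeds_later (x : 'I_t) : Prop :=
  forall y : 'I_t, (x < y)%N -> (a y < a x)%N.

(* i lists the positions i_1 < ... < i_q: each one is the smallest position
   beyond the previous ones satisfying exceeds_later, and i_q is the last
   position (at which exceeds_later holds vacuously). *)
Definition greedy_subsequence q (i : 'I_q -> 'I_t) : Prop :=
  [/\ forall p p' : 'I_q, (p < p')%N -> (i p < i p')%N,
      forall p, exceeds_later (i p),
      forall (p : 'I_q) (x : 'I_t), exceeds_later x ->
        (forall p' : 'I_q, (p' < p)%N -> (i p' < x)%N) -> (i p <= x)%N
    & exists2 p : 'I_q, p.+1 = q & (i p).+1 = t].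

End Subsequence.

(* Main.v *)
From Stdlib Require Import ClassicalEpsilon.
Require Import Defs.
From mathcomp Require Import all_boot all_order all_algebra zify.

Set Implicit Arguments.
Unset Strict Implicit.
Unset Printing Implicit Defensive.

Import GRing.Theory.

(** Order the minimal generators of M by degree and, within a degree, by last variable. The
    exchange property then makes the colon ideal of the previous generators by u the ideal of the
    variables x_l with l < m(u) not dividing u. Iterated mapping cones over Koszul complexes give a
    graded free resolution of M, in which the comparison maps strictly lower the degrees of the
    basis elements; hence it is minimal, and
    beta_(i,i+l)(M) = sum over u in G(M)_l of binomial(m(u) - l, i).
    Any two graded free resolutions being homotopy equivalent, these are the Betti numbers whatever
    the resolution. So beta_(i,i+l)(M) is nonzero iff l is some d_j and i <= m_(d_j) - d_j, the
    extremal Betti numbers sit at the positions j where m_(d_j) - d_j exceeds all later terms, and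
    these are exactly the positions picked by the greedy subsequence. *)

(** * Homogeneous polynomial matrices and their reduction modulo the variables *)

Section HomogeneousMatrices.
Local Open Scope ring_scope.
Variables (K : fieldType) (n : nat).
Local Notation S := {mpoly K[n]}.

Definition homog_mx m p (dA : 'I_m -> nat) (dB : 'I_p -> nat) (A : 'M[S]_(m, p)) :=
  forall a c u, u \in msupp (A a c) -> (mdeg u + dB c)%N = dA a.

Lemma homog_mx_mul m p q (dA : 'I_m -> nat) (dB : 'I_p -> nat) (dC : 'I_q -> nat)
    (A : 'M_(m, p)) (B : 'M_(p, q)) :
  homog_mx dA dB A -> homog_mx dB dC B -> homog_mx dA dC (A *m B).
Proof.
move=> hA hB a c u; rewrite mxE => /msupp_sum_le /flattenP[s] /mapP[b _ ->].
by move=> /msuppM_le /allpairsP[[v w] /= [/hA hv /hB hw ->]]; rewrite mdegD -addnA hw.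
Qed.

Lemma homog_mxN m p (dA : 'I_m -> nat) (dB : 'I_p -> nat) (A : 'M_(m, p)) :
  homog_mx dA dB A -> homog_mx dA dB (- A).
Proof. by move=> hA a c u; rewrite mxE (perm_mem (msuppN _)) => /hA. Qed.

Lemma homog_mxB m p (dA : 'I_m -> nat) (dB : 'I_p -> nat) (A B : 'M_(m, p)) :
  homog_mx dA dB A -> homog_mx dA dB B -> homog_mx dA dB (A - B).
Proof.
move=> hA hB a c u; rewrite !mxE => /msuppB_le; rewrite mem_cat.
by case/orP => [/hA|/hB].
Qed.

Lemma homog_mx0 m p (dA : 'I_m -> nat) (dB : 'I_p -> nat) : homog_mx dA dB 0.
Proof. by move=> a c u; rewrite mxE msupp0. Qed.

Lemma homog_mx1 m (d : 'I_m -> nat) : homog_mx d d 1%:M.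
Proof.
move=> a c u; rewrite mxE; case: eqP => [->|_]; last by rewrite msupp0.
by rewrite msupp1 inE => /eqP->; rewrite mdeg0.
Qed.

(** Serves both to extract homogeneous components and to take the remainder modulo a monomial. *)
Definition msel (P : pred 'X_{1..n}) (p : S) : S :=
  \sum_(u <- msupp p | P u) p@_u *: 'X_[u].

Lemma mcoeff_msel P p u : (msel P p)@_u = if P u then p@_u else 0.
Proof.
rewrite /msel raddf_sum /=; under eq_bigr do rewrite mcoeffZ mcoeffX.
have [pu|] := boolP (u \in msupp p).
  rewrite big_mkcond (bigD1_seq u) ?msupp_uniq //= eqxx mulr1.
  by rewrite big1 ?addr0 // => v /negPf->; rewrite mulr0 if_same.
move=> pu; rewrite (memN_msupp_eq0 pu) if_same big_seq_cond big1 // => v /andP[vp _].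
by case: eqP => [vu|]; rewrite ?mulr0 //; rewrite -vu vp in pu.
Qed.

(** Preimages chosen row by row need not be homogeneous. Dropping their terms of the wrong degree
    repairs this: as [V] and [D] are homogeneous, those terms contribute nothing to [V]. *)
Lemma homog_mx_lift m k p (dV : 'I_m -> nat) (dA : 'I_k -> nat) (dB : 'I_p -> nat)
    (V : 'M[S]_(m, p)) (D : 'M_(k, p)) :
  homog_mx dV dB V -> homog_mx dA dB D ->
  (forall i, exists w : 'rV_k, row i V = w *m D) ->
  exists W, homog_mx dV dA W /\ V = W *m D.
Proof.
move=> hV hD /fin_all_exists[w hw].
exists (\matrix_(a, c) msel (fun u => (mdeg u + dA c)%N == dV a) (w a 0 c)).
split=> [a c u|].
  rewrite mxE mcoeff_msupp mcoeff_msel.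
  by case: ifP => [/eqP //|_]; rewrite eqxx.
apply/matrixP => a c.
have -> : V a c = \sum_b w a 0 b * D b c by have /rowP/(_ c) := hw a; rewrite !mxE.
rewrite mxE; apply/mpolyP => u.
have [e|ne] := eqVneq (mdeg u + dB c)%N (dV a); last first.
  have -> : (\sum_b w a 0 b * D b c)@_u = 0.
    have -> : \sum_b w a 0 b * D b c = V a c.
      by have /rowP/(_ c) := hw a; rewrite !mxE.
    by apply/eqP; rewrite mcoeff_eq0; apply: contraNN ne => /hV ->.
  rewrite raddf_sum big1 // => b _ /=; rewrite mcoeffM big1 // => -[v z] /= /eqP uvz.
  rewrite mxE mcoeff_msel; case: eqP => [e|]; last by rewrite mul0r.
  have [/hD hz|/memN_msupp_eq0->] := boolP (val z \in msupp (D b c)); last by rewrite mulr0.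
  by case/eqP: ne; rewrite uvz mdegD -addnA hz.
(* In the right degree, every term of [w] that meets the support of [D] is one that [msel] keeps. *)
rewrite !raddf_sum; apply: eq_bigr => b _ /=; rewrite !mcoeffM.
apply: eq_bigr => -[v z] /= /eqP uvz; rewrite mxE mcoeff_msel.
have [/hD hz|/memN_msupp_eq0->] := boolP (val z \in msupp (D b c)); last by rewrite !mulr0.
by rewrite ifT // -hz addnA -mdegD -uvz e.
Qed.

Definition const_mx0 m p (A : 'M[S]_(m, p)) : 'M[K]_(m, p) := map_mx (mcoeff 0%MM) A.

Definition deg_part m (d : 'I_m -> nat) j : 'M[K]_m := diag_mx (\row_a (d a == j)%:R).

(** A nonzero constant term has degree 0, so it only links basis elements of equal degree. *)
Lemma deg_part_const_mx0 m p (dA : 'I_m -> nat) (dB : 'I_p -> nat) A j :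
  homog_mx dA dB A ->
  deg_part dA j *m const_mx0 A = const_mx0 A *m deg_part dB j.
Proof.
move=> hA; apply/matrixP => a c; rewrite mul_diag_mx mul_mx_diag !mxE.
have [/hA|/memN_msupp_eq0->] := boolP (0%MM \in msupp (A a c)); last by rewrite mulr0 mul0r.
by rewrite mdeg0 add0n => ->; rewrite mulrC.
Qed.

Lemma deg_part_idem m (d : 'I_m -> nat) j : deg_part d j *m deg_part d j = deg_part d j.
Proof.
rewrite mulmx_diag; congr diag_mx; apply/rowP => a; rewrite !mxE.
by case: eqP; rewrite ?mulr1 ?mulr0.
Qed.

Lemma rank_deg_part m (d : 'I_m -> nat) j :
  \rank (deg_part d j) = #|[pred a | d a == j]|.
Proof.
have -> : \rank (deg_part d j) = \rank (\sum_(a | d a == j) <<delta_mx 0 a : 'rV[K]_m>>)%MS.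
  apply/eqmx_rank/andP; split.
    apply/row_subP => a; rewrite rowE mul_mx_diag.
    have [da|da] := boolP (d a == j).
      apply: (sumsmx_sup a) => //; rewrite genmxE.
      apply/submxP; exists 1%:M; rewrite mul1mx; apply/rowP => b.
      by rewrite !mxE eqxx /=; case: eqP => [->|]; rewrite ?mul0r // da mulr1.
    rewrite [X in (X <= _)%MS](_ : _ = 0) ?sub0mx //; apply/rowP => b.
    by rewrite !mxE eqxx /=; case: eqP => [->|]; rewrite ?mul0r // (negPf da) mulr0.
  apply/sumsmx_subP => a da; rewrite genmxE; apply/submxP; exists (delta_mx 0 a).
  rewrite mul_mx_diag; apply/rowP => b.
  by rewrite !mxE eqxx /=; case: eqP => [->|]; rewrite ?mul0r // da mulr1.
have inj : {in [pred a | d a == j] &, injective (@id 'I_m)} by [].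
have /mxdirectP /= -> := mxdirect_delta K inj.
under eq_bigr do rewrite mxrank_gen mxrank_delta.
by rewrite sum1_card.
Qed.

Lemma sub_deg_part m p (d : 'I_m -> nat) j (A : 'M_(p, m)) :
  (A <= deg_part d j)%MS -> A *m deg_part d j = A.
Proof. by case/submxP => B ->; rewrite -mulmxA deg_part_idem. Qed.

End HomogeneousMatrices.

(** The type varies with the index because the matrices of a chain map change size. [Q] is the
    invariant that lets the construction continue, [R] the relation between consecutive terms. *)
Lemma dependent_choice (T : nat -> Type) (Q : forall i, T i -> Prop)
    (R : forall i, T i -> T i.+1 -> Prop) (x0 : T 0) :
  Q 0 x0 -> (forall i x, Q i x -> exists y, Q i.+1 y /\ R i x y) ->
  exists f : forall i, T i, f 0 = x0 /\ forall i, Q i (f i) /\ R i (f i) (f i.+1).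
Proof.
move=> Q0 step.
pose next i (x : {x | Q i x}) : {y | Q i.+1 y /\ R i (sval x) y} :=
  constructive_indefinite_description _ (step i _ (svalP x)).
pose g := fix g i : {x | Q i x} :=
  match i with
  | 0 => exist _ x0 Q0
  | i'.+1 => exist _ (sval (next i' (g i'))) (proj1 (svalP (next i' (g i'))))
  end.
exists (fun i => sval (g i)); split=> // i; split; first exact: svalP.
exact: (proj2 (svalP (next i (g i)))).
Qed.

(** * Lifting chain maps and homotopies through an exact complex *)

Section ChainMaps.
Local Open Scope ring_scope.
Variables (K : fieldType) (n : nat).
Local Notation S := {mpoly K[n]}.
Variables (rX rY : nat -> nat) (dX : forall i, 'I_(rX i) -> nat) (dY : forall i, 'I_(rY i) -> nat).
Variables (DX : forall i, 'M[S]_(rX i.+1, rX i)) (DY : forall i, 'M[S]_(rY i.+1, rY i)).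
Hypothesis homogX : forall i, homog_mx (@dX i.+1) (@dX i) (DX i).
Hypothesis homogY : forall i, homog_mx (@dY i.+1) (@dY i) (DY i).
Hypothesis complexX : forall i, DX i.+1 *m DX i = 0.
Hypothesis exactY : forall i (v : 'rV_(rY i.+1)), v *m DY i = 0 -> exists w, v = w *m DY i.+1.

(** The invariant is that [DX i *m f] lands in the image of [DY i]. A lift [f'] through [DY i]
    exists by it, and [DX i.+1 *m f'] is killed by [DY i], so exactness restores the invariant. *)
Lemma chain_lift (f0 : 'M_(rX 0, rY 0)) :
  homog_mx (@dX 0) (@dY 0) f0 ->
  (forall v : 'rV_(rX 1), exists w, v *m DX 0 *m f0 = w *m DY 0) ->
  exists f : forall i, 'M_(rX i, rY i),
    [/\ f 0 = f0, forall i, homog_mx (@dX i) (@dY i) (f i)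
      & forall i, DX i *m f i = f i.+1 *m DY i].
Proof.
move=> h0 im0.
have [i f [hf im_f]|f [f0E Hf]] := @dependent_choice (fun i => 'M[S]_(rX i, rY i))
  (fun i f => homog_mx (@dX i) (@dY i) f /\ forall v : 'rV_(rX i.+1), exists w, v *m DX i *m f = w *m DY i)
  (fun i f f' => DX i *m f = f' *m DY i) f0 (conj h0 im0).
- have [a|f' [hf' E]] := homog_mx_lift (homog_mx_mul (@homogX i) hf) (@homogY i).
    by rewrite row_mul rowE; apply: im_f.
  exists f'; split=> //; split=> // v; apply: exactY.
  by rewrite -!mulmxA -E (mulmxA (DX _)) complexX mul0mx mulmx0.
by exists f; split=> // i; [case: (Hf i) => -[] | case: (Hf i)].
Qed.

(** The invariant [DX i *m e i = DX i *m h *m DY i] says that [e i.+1 - DX i *m h] is killed by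
    [DY i]; by exactness it lifts through [DY i.+1], which gives the next [h]. *)
Lemma chain_homotopy (e : forall i, 'M[S]_(rX i, rY i)) :
  e 0 = 0 -> (forall i, homog_mx (@dX i) (@dY i) (e i)) ->
  (forall i, DX i *m e i = e i.+1 *m DY i) ->
  exists h : forall i, 'M[S]_(rX i, rY i.+1),
    [/\ h 0 = 0, forall i, homog_mx (@dX i) (@dY i.+1) (h i)
      & forall i, e i.+1 = h i.+1 *m DY i.+1 + DX i *m h i].
Proof.
move=> e0 he eD.
have [|i h [hh hD]|h [h0 Hh]] := @dependent_choice (fun i => 'M[S]_(rX i, rY i.+1))
  (fun i h => homog_mx (@dX i) (@dY i.+1) h /\ DX i *m e i = DX i *m h *m DY i)
  (fun i h h' => e i.+1 = h' *m DY i.+1 + DX i *m h) 0.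
- by split; [apply: homog_mx0 | rewrite e0 !mulmx0 mul0mx].
- have [a|h' [hh' E]] := homog_mx_lift
    (homog_mxB (he i.+1) (homog_mx_mul (@homogX i) hh)) (@homogY i.+1).
    by apply: exactY; rewrite -row_mul mulmxBl -eD hD subrr row0.
  have {}E : e i.+1 = h' *m DY i.+1 + DX i *m h by rewrite -E subrK.
  exists h'; do !split=> //.
  by rewrite E mulmxDr mulmxA [X in _ + X]mulmxA complexX mul0mx addr0.
by exists h; split=> // i; [case: (Hh i) => -[] | case: (Hh i)].
Qed.

End ChainMaps.

(** * Independence of Tor from the resolution *)

Section Resolutions.
Local Open Scope ring_scope.
Variables (K : fieldType) (n : nat).
Local Notation S := {mpoly K[n]}.

(* The augmented complex ... -> F_1 -> F_0 -> S^r, reindexed so that S^r sits in position 0. *)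
Section Augmented.
Variables (r : nat) (F : free_complex K n r).

Definition arank i : nat := if i is i'.+1 then crank F i' else r.

Definition adeg i : 'I_(arank i) -> nat :=
  match i with 0 => fun=> 0%N | i'.+1 => @cdeg _ _ _ F i' end.

Definition adiff i : 'M[S]_(arank i.+1, arank i) :=
  match i with 0 => caug F | i'.+1 => cdiff F i' end.

End Augmented.

Section AugmentedTheory.
Variables (r : nat) (M : 'rV[S]_r -> Prop) (F : free_complex K n r).
Hypothesis resF : graded_free_resolution F M.

Lemma homog_adiff i : homog_mx (@adeg _ F i.+1) (@adeg _ F i) (adiff F i).
Proof.
case: resF => -[hd ha] _ _ _; case: i => [|i] a c u /=; last exact: hd.
by move/ha=> ->; rewrite addn0.
Qed.

Lemma adiff_exact i (v : 'rV_(arank F i.+1)) :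
  v *m adiff F i = 0 <-> exists w, v = w *m adiff F i.+1.
Proof. by case: resF => _ _ e0 eS; case: i v => [|i] v; [apply: e0 | apply: eS]. Qed.

Lemma adiff_complex i : adiff F i.+1 *m adiff F i = 0.
Proof.
apply/row_matrixP => a; rewrite row0 row_mul; apply/adiff_exact.
by exists (delta_mx 0 a); rewrite -rowE.
Qed.

End AugmentedTheory.

Section Comparison.
Variables (r : nat) (M : 'rV[S]_r -> Prop) (F G : free_complex K n r).
Hypothesis resF : graded_free_resolution F M.
Hypothesis resG : graded_free_resolution G M.

(** Lifts the identity of [S^r]; the lift starts because both augmentations have image [M]. *)
Lemma comparison : exists f : forall i, 'M[S]_(arank F i, arank G i),
  [/\ f 0 = 1%:M, forall i, homog_mx (@adeg _ F i) (@adeg _ G i) (f i)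
    & forall i, adiff F i *m f i = f i.+1 *m adiff G i].
Proof.
apply: (chain_lift (homog_adiff resF) (homog_adiff resG) (adiff_complex resF)).
- by move=> i v; case: (adiff_exact resG v).
- exact: homog_mx1.
- move=> v; rewrite mulmx1; case: resG => _ hG _ _; apply/hG.
  by case: resF => _ hF _ _; apply/hF; exists v.
Qed.

End Comparison.

Lemma const_mx0M m p q (A : 'M[S]_(m, p)) (B : 'M[S]_(p, q)) :
  const_mx0 (A *m B) = const_mx0 A *m const_mx0 B.
Proof. exact: map_mxM. Qed.

Section TorIndependence.
Variables (r : nat) (M : 'rV[S]_r -> Prop).

(** Going from [F] to [G] and back is homotopic to the identity, so the homology of [F] is a
    quotient of a subspace of that of [G]. Exchanging the roles gives equality. *)
Lemma tor_dim_le (F G : free_complex K n r) i j :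
  graded_free_resolution F M -> graded_free_resolution G M ->
  (tor_dim F i j <= tor_dim G i j)%N.
Proof.
move=> resF resG.
have [f [f0 hf fD]] := comparison resF resG.
have [g [g0 hg gD]] := comparison resG resF.
have [||l|h [h0 hh hD]] := chain_homotopy (homog_adiff resF) (homog_adiff resF)
  (adiff_complex resF) (fun i v => proj1 (adiff_exact resF v))
  (e := fun i => f i *m g i - 1%:M).
- by rewrite f0 g0 mul1mx subrr.
- by move=> l; apply: homog_mxB (homog_mx1 _); apply: homog_mx_mul.
- by rewrite mulmxBr mulmxBl mulmx1 mul1mx mulmxA fD -!mulmxA gD.
pose c := @const_mx0 K n.
have sub_tp (H H' : free_complex K n r) (k : forall i, 'M[S]_(arank H i, arank H' i)) :
    (forall i, homog_mx (@adeg _ H i) (@adeg _ H' i) (k i)) ->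
    tpart H i j *m c _ _ (k i.+1) = c _ _ (k i.+1) *m tpart H' i j.
  by move=> hk; apply: (deg_part_const_mx0 j (hk i.+1)).
(* Chain maps preserve cycles and, next, boundaries. The index [i.+1] appears because position 0 of
   the augmented complex is [S^r]. *)
have cycles (H H' : free_complex K n r) (k : forall i, 'M[S]_(arank H i, arank H' i)) :
    (forall i, homog_mx (@adeg _ H i) (@adeg _ H' i) (k i)) ->
    (forall i, adiff H i *m k i = k i.+1 *m adiff H' i) ->
    (tcycles H i j *m c _ _ (k i.+1) <= tcycles H' i j)%MS.
  move=> hk kD; case: i sub_tp => [|i'] sub_tp /=; first by rewrite sub_tp ?submxMl.
  rewrite sub_capmx; apply/andP; split.
    apply: submx_trans (submxMr _ (capmxSl _ _)) _.
    by rewrite sub_tp // submxMl.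
  apply/sub_kermxP.
  have /(congr1 (c _ _)) := kD i'.+1; rewrite /c !const_mx0M /= => E.
  by rewrite -mulmxA -[tdiff H' i']/(c _ _ (cdiff H' i')) -E mulmxA
    (sub_kermxP (capmxSr _ _)) mul0mx.
have bounds (H H' : free_complex K n r) (k : forall i, 'M[S]_(arank H i, arank H' i)) :
    (forall i, homog_mx (@adeg _ H i) (@adeg _ H' i) (k i)) ->
    (forall i, adiff H i *m k i = k i.+1 *m adiff H' i) ->
    (tboundaries H i j *m c _ _ (k i.+1) <= tboundaries H' i j)%MS.
  move=> hk kD; rewrite /tboundaries.
  have /(congr1 (c _ _)) := kD i.+1; rewrite /c !const_mx0M /= => E.
  rewrite -mulmxA -[tdiff H i]/(c _ _ (cdiff H i)) E mulmxA.
  by rewrite [tpart H i.+1 j *m _](deg_part_const_mx0 j (hk i.+2)) -mulmxA submxMl.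
(* A cycle differs from its image under the round trip by a boundary. The other homotopy term
   vanishes on cycles; for [i = 0] it does so because [h 0 = 0]. *)
have htpy : (tcycles F i j <= tcycles F i j *m c _ _ (f i.+1) *m c _ _ (g i.+1)
    + tboundaries F i j)%MS.
  have /(congr1 (c _ _)) := hD i; rewrite /c /const_mx0 map_mxB map_mxD !map_mxM map_mx1 => E.
  rewrite -[X in (X <= _)%MS]mulmx1.
  rewrite -[1%:M](subKr (c _ _ (f i.+1) *m c _ _ (g i.+1))) /c /const_mx0 E.
  rewrite mulmxBr mulmxDr mulmxA; apply: addmx_sub_adds => //.
  rewrite eqmx_opp.
  have -> : tcycles F i j *m (map_mx (mcoeff 0%MM) (adiff F i) *m map_mx (mcoeff 0%MM) (h i)) = 0.
    case: i {sub_tp cycles bounds E} => [|i'] /=; first by rewrite h0 map_mx0 !mulmx0.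
    by rewrite mulmxA (sub_kermxP (capmxSr _ _)) mul0mx.
  rewrite addr0 mulmxA.
  have Zp : (tcycles F i j <= tpart F i j)%MS by case: (i) => [|i'] //=; apply: capmxSl.
  rewrite -{1}(sub_deg_part Zp) -[X in (X *m _ <= _)%MS]mulmxA.
  by rewrite (deg_part_const_mx0 j (hh i.+1)) -!mulmxA mulmxA; apply: submxMl.
set ZF := tcycles F i j; set ZG := tcycles G i j in cycles *.
set BF := tboundaries F i j; set BG := tboundaries G i j.
(* Since boundaries go to boundaries, a complement of [BG] in [ZG] is enough; its dimension is
   [tor_dim G i j]. *)
have sZW : (ZF <= (ZG :\: BG)%MS *m c _ _ (g i.+1) + BF)%MS.
  apply: submx_trans htpy _; rewrite addsmx_sub addsmxSr andbT.
  apply: submx_trans (submxMr _ (cycles _ _ f hf fD)) _.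
  rewrite -(eqmxMr _ (addsmx_diff_cap_eq ZG BG)) addsmxMr.
  apply: addsmxS => //; apply: submx_trans (bounds _ _ g hg gD).
  by apply: submxMr; apply: capmxSr.
rewrite /tor_dim -/ZF -/ZG -/BF -/BG leq_subLR.
apply: leq_trans (mxrankS sZW) _; apply: leq_trans (mxrank_adds_leqif _ _) _.
rewrite addnC leq_add2l; apply: leq_trans (mxrankM_maxl _ _) _.
(* This inclusion makes the natural subtraction in [tor_dim G i j] exact. *)
have sBZ : (BG <= ZG)%MS.
  rewrite /BG /ZG /tboundaries /tcycles.
  have sub k : (tpart G k.+1 j *m tdiff G k <= tpart G k j)%MS.
    by rewrite [_ *m _](deg_part_const_mx0 j (@homog_adiff _ _ _ resG k.+1)) submxMl.
  case: (i) => [|i']; first exact: sub.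
  rewrite sub_capmx sub; apply/sub_kermxP; rewrite -mulmxA -map_mxM.
  by rewrite [X in map_mx _ X](@adiff_complex _ _ _ resG i'.+1) map_mx0 mulmx0.
by rewrite -(mxrank_cap_compl ZG BG) (capmx_idPr sBZ) addKn.
Qed.

(** The resolution chosen by [epsilon] may be replaced by [F], whose reduced differentials vanish:
    everything is a cycle and only zero is a boundary. *)
Lemma betti_minimal (F : free_complex K n r) i j :
  graded_free_resolution F M -> (forall l, tdiff F l = 0) ->
  betti M i j = #|[pred a : 'I_(crank F i) | cdeg a == j]|.
Proof.
move=> resF minF; rewrite /betti; set G := epsilon _ _.
have resG : graded_free_resolution G M.
  exact: (epsilon_spec _ (fun F => graded_free_resolution F M) (ex_intro _ F resF)).
have -> : tor_dim G i j = tor_dim F i j by apply/eqP; rewrite eqn_leq !tor_dim_le.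
rewrite /tor_dim /tboundaries minF mulmx0 mxrank0 subn0 -(rank_deg_part K).
case: i => [|i] //=; have /capmx_idPl-> // : (tpart F i.+1 j <= kermx (tdiff F i))%MS.
by apply/sub_kermxP; rewrite minF mulmx0.
Qed.

End TorIndependence.
End Resolutions.

(** * Mapping cones of graded complexes *)

Lemma split_lshift m p (a : 'I_m) : split (lshift p a) = inl a.
Proof. exact: (unsplitK (inl a)). Qed.

Lemma split_rshift m p (b : 'I_p) : split (rshift m b) = inr b.
Proof. exact: (unsplitK (inr b)). Qed.

Section MappingCone.
Local Open Scope ring_scope.
Variables (K : fieldType) (n r : nat).
Local Notation S := {mpoly K[n]}.

Section Cone.
Variables (F : free_complex K n r) (H : free_complex K n 1) (e : nat).
Variable f : forall i, 'M[S]_(arank H i, arank F i).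

(** The augmented complex of [H], shifted by [e], is glued onto [F]; its position 0 becomes a new
    generator of degree [e]. The usual sign is carried by [f], which anticommutes with the
    differentials ([fD]). *)
Definition cone : free_complex K n r :=
  @FreeComplex K n r (fun i => crank F i + arank H i)%N
    (fun i a => match split a with inl b => cdeg b | inr b => (adeg b + e)%N end)
    (fun i => block_mx (cdiff F i) 0 (f i.+1) (adiff H i))
    (col_mx (caug F) (f 0)).

Variables (A B : 'rV[S]_r -> Prop) (L : 'rV[S]_1 -> Prop).
Hypothesis resF : graded_free_resolution F B.
Hypothesis resH : graded_free_resolution H L.
Hypothesis homf : forall i, homog_mx (fun a => @adeg _ _ _ H i a + e)%N (@adeg _ _ _ F i) (f i).
Hypothesis fD : forall i, adiff H i *m f i = - (f i.+1 *m adiff F i).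

(** With [b = c *m adiff H j], anticommutation turns the hypothesis into [a - c *m f j.+1] being a
    cycle of [F], hence a boundary. *)
Lemma cone_kernel j (a : 'rV_(arank F j.+1)) (b : 'rV_(arank H j)) :
  (exists c, b = c *m adiff H j) ->
  a *m adiff F j + b *m f j = 0 ->
  exists w c, a = w *m adiff F j.+1 + c *m f j.+1 /\ b = c *m adiff H j.
Proof.
case=> c ->; rewrite -mulmxA fD mulmxN mulmxA -mulmxBl => /(adiff_exact resF)[w aE].
by exists w, c; split=> //; rewrite -aE subrK.
Qed.

Lemma cone_complex j (w : 'rV_(arank F j.+2)) (c : 'rV_(arank H j.+1)) :
  (w *m adiff F j.+1 + c *m f j.+1) *m adiff F j + c *m adiff H j *m f j = 0.
Proof.
rewrite mulmxDl -!mulmxA (adiff_complex resF) mulmx0 add0r fD mulmxN.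
exact: subrr.
Qed.

Lemma homog_cone : homogeneous_complex cone.
Proof.
have homF := homog_adiff resF; have homH := homog_adiff resH.
split=> [i a c u|a k u] /=.
  case: (split_ordP a) => a' ->; case: (split_ordP c) => c' ->;
    rewrite ?split_lshift ?split_rshift.
  - by rewrite block_mxEul => /(homF i.+1).
  - by rewrite block_mxEur mxE msupp0.
  - by rewrite block_mxEdl => /(homf (i := i.+1)).
  - by rewrite block_mxEdr addnA => /homH ->.
case: (split_ordP a) => a' ->.
  by rewrite col_mxEu => /(homF 0); rewrite addn0.
by rewrite col_mxEd => /(homf (i := 0)); rewrite addn0.
Qed.

(** The hypotheses say that [A] is [B] plus the multiples of [f 0], and that [L] is the colon of [B]
    by [f 0]. *)
Lemma cone_resolution :
  (forall x, A x <-> exists y b, B y /\ x = y + b *m f 0) ->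
  (forall b : 'rV_1, B (b *m f 0) <-> L b) ->
  graded_free_resolution cone A.
Proof.
move=> AE BE; case: (resF) (resH) => _ BF _ _ [_ LH _ _].
split; first exact: homog_cone.
- move=> x; rewrite AE; split=> [[y [b [/BF[v ->] ->]]]|[v ->]].
    by exists (row_mx v b); rewrite mul_row_col.
  exists (lsubmx v *m caug F), (rsubmx v); split; first by apply/BF; exists (lsubmx v).
  by rewrite -{1}[v]hsubmxK mul_row_col.
- move=> v; rewrite -[v]hsubmxK mul_row_col; split=> [v0|[w]].
    (* A relation puts a multiple of [f 0] in [B], so its coefficient lies in the colon [L], the
       image of the augmentation of [H]. *)
    have [|w [c [aE bE]]] := @cone_kernel 0 _ _ _ v0.
      apply/LH/BE/BF; exists (- lsubmx v); apply/eqP.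
      by rewrite mulNmx -addr_eq0 addrC v0.
    by exists (row_mx w c); rewrite mul_row_block mulmx0 add0r aE bE.
  rewrite -[w]hsubmxK mul_row_block mulmx0 add0r => /eq_row_mx[-> ->].
  exact: (@cone_complex 0).
- move=> i v; rewrite -[v]hsubmxK mul_row_block mulmx0 add0r -row_mx0.
  split=> [/eq_row_mx[v0 v1]|[w]].
    have [|w [c [aE bE]]] := @cone_kernel i.+1 _ _ _ v0; first exact/(adiff_exact resH).
    by exists (row_mx w c); rewrite mul_row_block mulmx0 add0r aE bE.
  rewrite -[w]hsubmxK mul_row_block mulmx0 add0r => /eq_row_mx[-> ->].
  congr row_mx; first exact: (@cone_complex i.+1).
  by rewrite -mulmxA (adiff_complex resH) mulmx0.
Qed.

(** Only the block [f i.+1] is new; a nonzero constant term in it would link basis elements of equal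
    degree, which the strict inequality excludes. *)
Lemma cone_minimal :
  (forall i, tdiff F i = 0) -> (forall i, const_mx0 (adiff H i) = 0) ->
  (forall i (c : 'I_(crank F i)) (a : 'I_(crank H i)), (cdeg c < cdeg a + e)%N) ->
  forall i, tdiff cone i = 0.
Proof.
move=> minF minH lt i; rewrite /tdiff /= map_block_mx.
rewrite [X in block_mx X _ _ _]minF [X in block_mx _ _ _ X]minH map_mx0.
rewrite (_ : map_mx _ (f i.+1) = 0) ?block_mx0 //; apply/matrixP => a c; rewrite !mxE.
apply/eqP; rewrite mcoeff_eq0; apply: contraL (lt i c a) => /homf /=.
by rewrite mdeg0 add0n => ->; rewrite ltnn.
Qed.

Lemma card_cone_deg i j :
  #|[pred a : 'I_(crank cone i) | cdeg a == j]| =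
  (#|[pred a : 'I_(crank F i) | cdeg a == j]| +
   #|[pred a : 'I_(arank H i) | (adeg a + e)%N == j]|)%N.
Proof.
rewrite -!sum1_card big_split_ord /=; congr (_ + _)%N; apply: eq_bigl => a; rewrite !inE /=.
  by rewrite split_lshift.
by rewrite split_rshift.
Qed.

End Cone.

(** Lifting against the negated differentials of [H] produces the anticommuting maps that [cone]
    expects. *)
Lemma cone_lift (F : free_complex K n r) (H : free_complex K n 1) e B L (f0 : 'M[S]_(1, r)) :
  graded_free_resolution F B -> graded_free_resolution H L ->
  homog_mx (fun=> e) (fun=> 0%N) f0 ->
  (forall b, L b -> B (b *m f0)) ->
  exists f : forall i, 'M[S]_(arank H i, arank F i),
    [/\ f 0 = f0,
        forall i, homog_mx (fun a => @adeg _ _ _ H i a + e)%N (@adeg _ _ _ F i) (f i)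
      & forall i, adiff H i *m f i = - (f i.+1 *m adiff F i)].
Proof.
move=> resF resH hf0 LB.
have [||||||f [f00 hf fD]] := @chain_lift K n (arank H) (arank F)
  (fun i a => @adeg _ _ _ H i a + e)%N (@adeg _ _ _ F) (fun i => - adiff H i) (adiff F) _ _ _ _ f0.
- by move=> i; apply: homog_mxN => a c u /(homog_adiff resH) <-; rewrite addnA.
- exact: homog_adiff resF.
- by move=> i; rewrite mulmxN mulNmx (adiff_complex resH) !oppr0.
- by move=> i v; case: (adiff_exact resF v).
- exact: hf0.
- move=> v; case: (resF) (resH) => _ BF _ _ [_ LH _ _]; apply/BF/LB/LH.
  by exists (- v); rewrite mulmxN mulNmx.
- exists f; split=> [||i]; [exact: f00 | exact: hf | ].
  by rewrite -fD mulNmx opprK.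
Qed.

End MappingCone.

(** * Minimality and basis counts under iterated cones *)

Section MinimalResolutions.
Local Open Scope ring_scope.
Variables (K : fieldType) (n : nat).
Local Notation S := {mpoly K[n]}.

(* A pair (e, l) in T stands for a generator of degree e whose colon ideal against the previous
   generators is generated by l variables. *)
Definition minimal_resolution r (F : free_complex K n r) M (T : seq (nat * nat)) :=
  [/\ graded_free_resolution F M, forall i, tdiff F i = 0
    & forall i j, #|[pred a : 'I_(crank F i) | cdeg a == j]| =
                  (\sum_(g <- T) (g.1 + i == j) * 'C(g.2, i))%N].

(** The Koszul complex as an iterated cone: the colon of the previous [l'] variables by the next one
    is generated by those [l'] variables. *)
Fixpoint koszul_type l : seq (nat * nat) :=
  if l is l'.+1 then (1%N, l') :: koszul_type l' else [::].

(** Pascal's rule summed up. The exponent is [i.+1] because the ideal is resolved, not its quotient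
    ring. *)
Lemma sum_koszul_type l i j :
  (\sum_(g <- koszul_type l) (g.1 + i == j) * 'C(g.2, i) = (i.+1 == j) * 'C(l, i.+1))%N.
Proof.
elim: l => [|l IHl] /=; first by rewrite big_nil bin0n muln0.
by rewrite big_cons IHl binS mulnDr addnC add1n.
Qed.

(** Basis elements of [H] in position [i] have degree [i.+1], those of [F] degree at most [e + i].
    After the shift by [e] the comparison maps strictly lower degrees, so minimality persists. *)
Lemma minimal_resolution_cone r B A (L : 'rV[S]_1 -> Prop) (F : free_complex K n r)
    (H : free_complex K n 1) T e l (f0 : 'M[S]_(1, r)) :
  minimal_resolution F B T -> minimal_resolution H L (koszul_type l) ->
  homog_mx (fun=> e) (fun=> 0%N) f0 ->
  {in T, forall g, g.1 <= e}%N ->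
  (forall x, A x <-> exists y b, B y /\ x = y + b *m f0) ->
  (forall b : 'rV_1, B (b *m f0) <-> L b) ->
  exists G : free_complex K n r, minimal_resolution G A ((e, l) :: T).
Proof.
move=> [resF minF cF] [resH minH cH] hf0 leT AE BE.
have degH i (a : 'I_(crank H i)) : cdeg a = i.+1.
  have : (0 < #|[pred b : 'I_(crank H i) | cdeg b == cdeg a]|)%N.
    by apply/card_gt0P; exists a; rewrite inE.
  by rewrite cH sum_koszul_type; case: eqP.
have degF i (a : 'I_(crank F i)) : (cdeg a <= e + i)%N.
  have : (0 < #|[pred b : 'I_(crank F i) | cdeg b == cdeg a]|)%N.
    by apply/card_gt0P; exists a; rewrite inE.
  rewrite cF; apply: contraTT; rewrite -ltnNge -leqNgt leqn0 => lt.
  rewrite big_seq big1 // => g /leT ge; case: eqP => // E.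
  by rewrite -E ltn_add2r ltnNge ge in lt.
have [f [f00 hf fD]] := cone_lift resF resH hf0 (fun b => proj2 (BE b)).
exists (cone e f); split.
- by apply: (cone_resolution resF resH hf fD); rewrite f00.
- apply: (cone_minimal hf minF) => [i|i c a].
    case: i => [|i]; last exact: minH.
    apply/matrixP => a c; rewrite !mxE; apply/eqP; rewrite mcoeff_eq0.
    apply/negP => /(homog_adiff resH (i := 0)) /=.
    by rewrite degH mdeg0.
  by rewrite degH addnC addnS ltnS.
move=> i j; rewrite card_cone_deg cF big_cons addnC; congr (_ + _)%N => /=.
case: i => [|i] /=.
  (* Position 0 of the augmented [H] is the ring itself: one basis element, of degree [e] after the
     shift. *)
  rewrite bin0 muln1 addn0 -sum1_card big_mkcond big_ord1 !inE /= add0n.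
  by case: eqP.
case: (leqP e j) => [ej|lt].
  transitivity #|[pred b : 'I_(crank H i) | cdeg b == (j - e)%N]|.
    by apply: eq_card => b; rewrite !inE -[RHS](eqn_add2r e) subnK.
  by rewrite cH sum_koszul_type -(eqn_add2r e i.+1) subnK // addnC.
rewrite (_ : (_ == _) = false); last by rewrite gtn_eqF // ltn_addr.
apply: eq_card0 => b; rewrite !inE; apply: gtn_eqF; exact: ltn_addl.
Qed.

End MinimalResolutions.

(** * Monomial submodules and linear quotients *)

Section MonomialSubmodules.
Local Open Scope ring_scope.
Variables (K : fieldType) (n : nat).
Local Notation S := {mpoly K[n]}.

Definition monomial_submodule r (U : 'I_r -> pred 'X_{1..n}) (x : 'rV[S]_r) : Prop :=
  forall k w, w \in msupp (x 0 k) -> U k w.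

Section AddGenerator.
Variables (r : nat) (U : 'I_r -> pred 'X_{1..n}) (k : 'I_r) (u : 'X_{1..n}).

Definition generator_row : 'M[S]_(1, r) := 'X_[u] *: delta_mx 0 k.

Lemma homog_generator_row : homog_mx (fun=> mdeg u) (fun=> 0%N) generator_row.
Proof.
move=> a c w; rewrite !mxE addn0; case: (_ && _); last by rewrite mulr0 msupp0.
by rewrite mulr1 => /mem_msuppXP->.
Qed.

Lemma mul_generator_row (b : 'rV_1) l :
  (b *m generator_row) 0 l = if k == l then b 0 0 * 'X_[u] else 0.
Proof.
rewrite mxE big_ord1 !mxE eqxx /= eq_sym.
by case: (_ == _); rewrite ?mulr1 ?mulr0.
Qed.

Lemma monomial_submodule_adjoin x :
  monomial_submodule (fun l w => (k == l) && (u <= w)%MM || U l w) x <->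
  exists y b, (monomial_submodule U y) /\ x = y + b *m generator_row.
Proof.
split=> [Ux|[y [b [Uy ->]]] l w].
  pose p := x 0 k.
  (* Division of the [k]-th entry by ['X_[u]]: the remainder consists of the terms that [u] does not
     divide. *)
  pose b : S := \sum_(w <- msupp p | (u <= w)%MM) p@_w *: 'X_[w - u].
  exists (x - b%:M *m generator_row), b%:M; split; last by rewrite subrK.
  have pb : p - b * 'X_[u] = msel (fun w => ~~ (u <= w)%MM) p.
    rewrite {1}[p]mpolyE (bigID (fun w => (u <= w)%MM)) /= /b mulr_suml addrAC -sumrB.
    rewrite big1 ?add0r // => w uw.
    by rewrite -scalerAl -mpolyXD submK // subrr.
  move=> l w; rewrite mxE [X in _ + X]mxE mul_generator_row [b%:M 0 0]mxE eqxx mulr1n.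
  have [<-|ne] := eqVneq k l.
    rewrite -/p pb mcoeff_msupp mcoeff_msel; case: ifP => [nuw|]; last by rewrite eqxx.
    by rewrite -mcoeff_msupp => /Ux; rewrite (negPf nuw) andbF.
  by rewrite subr0 => /Ux; rewrite (negPf ne).
rewrite mxE mul_generator_row => /msuppD_le; rewrite mem_cat => /orP[/Uy->|]; first exact: orbT.
case: eqP => [<-|_]; last by rewrite msupp0.
by rewrite (perm_mem (msuppMX _ _)) => /mapP[v _ ->]; rewrite lem_addr.
Qed.

Lemma monomial_submodule_colon (P : pred 'X_{1..n}) (b : 'rV_1) :
  (forall w, U k (u + w)%MM = P w) ->
  monomial_submodule U (b *m generator_row) <-> monomial_submodule (fun=> P) b.
Proof.
move=> UP; split=> Ub l w.
  rewrite (ord1 l) => wb; rewrite -UP; apply: Ub; rewrite mul_generator_row eqxx.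
  by rewrite (perm_mem (msuppMX _ _)); apply: map_f.
rewrite mul_generator_row; case: eqP => [<-|_]; last by rewrite msupp0.
by rewrite (perm_mem (msuppMX _ _)) => /mapP[v /Ub Pv ->]; rewrite UP.
Qed.

End AddGenerator.

Lemma zero_minimal_resolution r (M : 'rV[S]_r -> Prop) :
  (forall x, M x <-> x = 0) -> minimal_resolution (zero_complex K n r) M [::].
Proof.
move=> M0; split.
- split.
  + by split=> [i []|[]].
  + move=> x; rewrite M0; split=> [->|[v ->]]; last by rewrite mulmx0.
    by exists 0; rewrite mulmx0.
  + by move=> v; split=> _; [exists 0; apply/rowP => -[] | rewrite mulmx0].
  + by move=> i v; split=> _; [exists 0; apply/rowP => -[] | rewrite mulmx0].
- by move=> i; apply/matrixP => -[].
- by move=> i j; rewrite big_nil; apply: eq_card0 => -[].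
Qed.

Lemma monomial_submodule0 r (x : 'rV[S]_r) :
  monomial_submodule (fun _ => pred0) x <-> x = 0.
Proof.
split=> [Ux|-> k w]; last by rewrite mxE msupp0.
apply/rowP => k; rewrite mxE; apply/eqP; rewrite -msupp_eq0.
by case E: (msupp _) => [//|w s]; have := Ux k w; rewrite E mem_head => /(_ isT).
Qed.

Lemma minimal_resolution_ext r (F : free_complex K n r) M M' T :
  (forall x, M x <-> M' x) -> minimal_resolution F M T -> minimal_resolution F M' T.
Proof.
move=> MM' [[? FM ? ?] ? ?]; split=> //; split=> // x.
by rewrite -MM' FM.
Qed.

Definition var_ideal (s : seq 'I_n) : pred 'X_{1..n} :=
  [pred w : 'X_{1..n} | has (fun l => w l != 0%N) s].

(** The colon of the ideal of [s] by a variable outside [s] is that ideal again, so [H] enters the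
    cone in both roles. *)
Lemma koszul_resolution (s : seq 'I_n) : uniq s ->
  exists H : free_complex K n 1, minimal_resolution H
    (monomial_submodule (fun=> var_ideal s)) (koszul_type (size s)).
Proof.
elim: s => [_|x s IHs /= /andP[xs /IHs[H resH]]].
  by exists (zero_complex K n 1); apply/zero_minimal_resolution/monomial_submodule0.
have := @homog_generator_row 1 0 U_(x)%MM; rewrite mdeg1 => homx.
apply: (minimal_resolution_cone resH resH homx).
- by move=> g; elim: (size s) => //= l IHl; rewrite inE => /orP[/eqP->|/IHl].
- by move=> y; rewrite -monomial_submodule_adjoin; split=> My k w /My; rewrite (ord1 k) /= lep1mP.
- move=> b; apply: monomial_submodule_colon => w /=; apply: eq_in_has => l ls.
  by rewrite mnmDE mnm1E; case: (x =P l) => // xl; rewrite xl ls in xs.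
Qed.

Section LinearQuotients.
Variable r : nat.
Implicit Types (g : 'I_r * 'X_{1..n}) (gs : seq ('I_r * 'X_{1..n})).

Definition generated_by gs (k : 'I_r) : pred 'X_{1..n} :=
  [pred w : 'X_{1..n} | has (fun g => (g.1 == k) && (g.2 <= w)%MM) gs].

(* The generators are added from the last to the first. *)
Fixpoint linear_quotients (L : 'I_r * 'X_{1..n} -> seq 'I_n) gs : Prop :=
  if gs is g :: gs' then
    [/\ linear_quotients L gs', {in gs', forall h, mdeg h.2 <= mdeg g.2}%N, uniq (L g)
      & forall w, generated_by gs' g.1 (g.2 + w)%MM = var_ideal (L g) w]
  else True.

Lemma linear_quotients_resolution L gs : linear_quotients L gs ->
  exists F : free_complex K n r, minimal_resolution F (monomial_submodule (generated_by gs))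
    [seq (mdeg g.2, size (L g)) | g <- gs].
Proof.
elim: gs => [_|g gs IHgs /= [/IHgs[F resF] le_deg uL colon]].
  by exists (zero_complex K n r); apply/zero_minimal_resolution/monomial_submodule0.
have [H resH] := koszul_resolution uL.
apply: (minimal_resolution_cone resF resH (@homog_generator_row r g.1 g.2)).
- by move=> _ /mapP[h /le_deg hg ->].
- by move=> x; apply: monomial_submodule_adjoin.
- by move=> b; apply: monomial_submodule_colon.
Qed.

Lemma linear_quotients_betti L gs M i j : linear_quotients L gs ->
  (forall x, M x <-> monomial_submodule (generated_by gs) x) ->
  betti M i j = (\sum_(g <- gs) (mdeg g.2 + i == j) * 'C(size (L g), i))%N.
Proof.
move=> /linear_quotients_resolution[F resF] MU.
have [resF' minF cF] := minimal_resolution_ext (fun x => iff_sym (MU x)) resF.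
by rewrite (betti_minimal _ _ resF' minF) cF big_map.
Qed.

End LinearQuotients.
End MonomialSubmodules.

(** * Degrees, last variables and gaps of monomials *)

Section Multinomials.
Variable n : nat.
Implicit Types u v w : 'X_{1..n}.

Lemma lem_mdeg u v : (u <= v)%MM -> mdeg u <= mdeg v.
Proof. by move=> uv; rewrite -(submK uv) mdegD leq_addl. Qed.

Lemma lem_mdeg_eq u v : (u <= v)%MM -> mdeg v <= mdeg u -> u = v.
Proof.
move=> uv; rewrite -{1 2}(submK uv) mdegD -{2}[mdeg u]add0n leq_add2r leqn0 mdeg_eq0.
by move/eqP=> ->; rewrite add0m.
Qed.

Lemma max_var_le u : max_var u <= n.
Proof. by apply/bigmax_leqP => i _; apply: ltn_ord. Qed.

Lemma ltn_max_var u (i : 'I_n) : u i != 0 -> i < max_var u.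
Proof. exact: (@leq_bigmax_cond _ _ (fun i : 'I_n => i.+1)). Qed.

Lemma max_var_leq u m : (forall i : 'I_n, u i != 0 -> i < m) -> max_var u <= m.
Proof. by move=> h; apply/bigmax_leqP => i /h. Qed.

Lemma max_var_witness u : 0 < max_var u -> exists2 i : 'I_n, u i != 0 & i.+1 = max_var u.
Proof.
move=> mv0; have [|i ui E] := @eq_bigmax_cond _ [pred i | u i != 0] (fun i : 'I_n => i.+1).
  apply: contraTT mv0; rewrite -!leqNgt !leqn0 => /eqP/card0_eq e0.
  by rewrite /max_var big1 // => i ui; have := e0 i; rewrite !inE ui.
by exists i => //; rewrite -E; apply: eq_bigl.
Qed.

Lemma squarefree_mdeg u : squarefree u -> mdeg u <= n.
Proof.
move=> sf; rewrite mdegE; apply: leq_trans (_ : \sum_(i < n) 1 <= n); last by rewrite sum1_card card_ord.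
by apply: leq_sum => i _.
Qed.

(** These variables will generate the colon ideal at the generator [u]. *)
Definition gap_vars u : seq 'I_n := [seq l : 'I_n <- enum 'I_n | (l < max_var u) && (u l == 0)].

(** Each index below [max_var u] is either a gap or contributes exactly 1 to the degree. *)
Lemma size_gap_vars u : squarefree u -> size (gap_vars u) + mdeg u = max_var u.
Proof.
move=> sf; rewrite size_filter -sum1_count big_enum_cond /= big_mkcond mdegE -big_split /=.
transitivity (\sum_(i < n | i < max_var u) 1).
  rewrite [RHS]big_mkcond; apply: eq_bigr => i _.
  have := @ltn_max_var u i; have := sf i.
  by case: (u i) => [|[|//]] _ h; rewrite ?andbT ?andbF ?addn0 // h.
by rewrite -(big_ord_widen n (fun=> 1)) ?max_var_le // sum1_card card_ord.
Qed.

End Multinomials.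

(** * Minimal generators of monomial ideals and the stable exchange *)

Section MonomialIdeals.
Local Open Scope ring_scope.
Variables (K : fieldType) (n : nat).
Local Notation S := {mpoly K[n]}.
Implicit Types (A B : 'X_{1..n} -> Prop) (I : S -> Prop) (u v w : 'X_{1..n}).

Lemma in_spanP A (p : S) :
  in_span A p <-> forall w, w \in msupp p -> exists2 a, A a & (a <= w)%MM.
Proof.
split=> [[s sA ->] w|Ap].
  move=> /msupp_sum_le /flattenP[t] /mapP[x]; rewrite filter_predT => xs ->.
  rewrite (perm_mem (msuppMX _ _)) => /mapP[v _ ->].
  by exists x.2; [apply: sA | apply: lem_addr].
pose a w := epsilon (inhabits w) (fun a => A a /\ (a <= w)%MM).
have aP w : w \in msupp p -> A (a w) /\ (a w <= w)%MM.
  case/Ap=> b Ab bw.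
  exact: (epsilon_spec _ (fun a => A a /\ (a <= w)%MM) (ex_intro _ b (conj Ab bw))).
exists [seq (p@_w *: 'X_[w - a w], a w) | w <- msupp p].
  by move=> _ /mapP[w /aP[Aw _] ->].
rewrite big_map {1}[p]mpolyE big_seq [RHS]big_seq; apply: eq_bigr => w /aP[_ aw] /=.
by rewrite -scalerAl -mpolyXD submK.
Qed.

Lemma generates_monomial A I w : generates A I ->
  (I 'X_[w] <-> exists2 a, A a & (a <= w)%MM).
Proof.
move=> gA; rewrite gA in_spanP; split=> [/(_ w)|Aw v]; first by apply; rewrite msuppX inE.
by rewrite msuppX inE => /eqP->.
Qed.

Lemma generates_mem A I p : generates A I ->
  (I p <-> forall w, w \in msupp p -> I 'X_[w]).
Proof.
move=> gA; rewrite {1}(gA p) in_spanP.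
by split=> h w /h /(generates_monomial w gA).
Qed.

Lemma generates_upward A I u v : generates A I -> I 'X_[u] -> (u <= v)%MM -> I 'X_[v].
Proof.
move=> gA /(generates_monomial u gA)[a Aa au] uv; apply/(generates_monomial v gA).
by exists a => //; apply: lepm_trans uv.
Qed.

Definition minimal_monomial I u : Prop :=
  I 'X_[u] /\ forall v, I 'X_[v] -> (v <= u)%MM -> v = u.

Lemma minimal_monomial_below A I w : generates A I -> I 'X_[w] ->
  exists2 v, minimal_monomial I v & (v <= w)%MM.
Proof.
move=> gA; have [N] := ubnP (mdeg w); elim: N w => // N IHN w lt Iw.
have [min|] := classic (forall v, I 'X_[v] -> (v <= w)%MM -> v = w).
  by exists w => //; apply: lepm_refl.
move=> /not_all_ex_not[v h]; have [Iv h'] := imply_to_and _ _ h.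
have [vw ne] := imply_to_and _ _ h'.
have [|z zmin zv] := IHN v _ Iv; last by exists z => //; apply: lepm_trans vw.
rewrite ltnS in lt; apply: leq_trans lt; rewrite ltnNge; apply/negP => wv.
by apply: ne; apply: lem_mdeg_eq.
Qed.

(** Replaces inclusion-minimality of generating sets by minimality under divisibility, which the
    later arguments use. *)
Lemma min_genP A I u : generates A I -> (min_gen I u <-> minimal_monomial I u).
Proof.
move=> gA; split=> [[A' [gA' minA'] A'u]|umin].
  split=> [|v /(generates_monomial v gA')[a A'a av] vu].
    by apply/(generates_monomial u gA'); exists u => //; apply: lepm_refl.
  have au := lepm_trans av vu.
  have [aE|ne] := eqVneq a u; first by apply: lem_mdeg_eq => //; rewrite -aE lem_mdeg.
  (* If some [a] in [A'] divides [u] and differs from it, then [A'] without [u] still generates,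
     against minimality. *)
  have [||_ []//] := minA' (fun w => A' w /\ w <> u) _ _ u A'u.
    by move=> w [].
  move=> p; rewrite (gA' p) !in_spanP; split=> h w /h[b].
    move=> A'b bw; have [bE|/eqP nb] := eqVneq b u; last by exists b.
    exists a; first by split=> //; apply/eqP.
    by apply: lepm_trans au _; rewrite -bE.
  by case=> A'b _ bw; exists b.
exists (minimal_monomial I) => //; split=> [p|B BA gB w [Iw wmin]].
  rewrite (generates_mem p gA) in_spanP; split=> h w /h.
    exact: minimal_monomial_below.
  by case=> a [Ia _]; apply: (generates_upward gA).
have /(generates_monomial w gB)[b Bb bw] := Iw.
by rewrite -(wmin b) //; case: (BA b Bb).
Qed.

Section StableIdeal.
Variable I : S -> Prop.
Hypothesis stI : squarefree_stable_ideal I.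

Lemma stable_generates : exists2 A, (forall u, A u -> squarefree u) & generates A I.
Proof. by case: stI. Qed.

Lemma stable_min_genP u : min_gen I u <-> minimal_monomial I u.
Proof. by have [A _ gA] := stable_generates; apply: min_genP gA. Qed.

Lemma stable_min_gen_below w : I 'X_[w] -> exists2 v, min_gen I v & (v <= w)%MM.
Proof.
have [A _ gA] := stable_generates => /(minimal_monomial_below gA)[v vmin vw].
by exists v => //; apply/stable_min_genP.
Qed.

Lemma stable_min_gen_squarefree u : min_gen I u -> squarefree u.
Proof.
have [A sfA gA] := stable_generates => /stable_min_genP[Iu umin].
have /(generates_monomial u gA)[a Aa au] := Iu.
rewrite -(umin a) //; first exact: sfA.
by apply/(generates_monomial a gA); exists a => //; apply: lepm_refl.
Qed.

Lemma stable_min_gen_mem u : min_gen I u -> I 'X_[u].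
Proof. by case/stable_min_genP. Qed.

Lemma stable_min_gen_antichain u v : min_gen I u -> min_gen I v -> (v <= u)%MM -> v = u.
Proof. by move=> /stable_min_genP[_ umin] /stable_min_genP[Iv _]; apply: umin. Qed.

Lemma stable_memP p : I p <-> forall w, w \in msupp p -> exists2 v, min_gen I v & (v <= w)%MM.
Proof.
have [A _ gA] := stable_generates; rewrite (generates_mem p gA); split=> h w /h.
  exact: stable_min_gen_below.
by case=> v /stable_min_gen_mem Iv; apply: (generates_upward gA).
Qed.

(* The exchanges x_j v / x_m(v) with j in supp(u) bring the divisor v of u w inside u. *)
Lemma stable_descent u w v :
  min_gen I u -> (forall l, l \in gap_vars u -> w l = 0%N) ->
  min_gen I v -> (v <= u + w)%MM -> (mdeg v <= mdeg u)%N ->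
  exists v', [/\ min_gen I v', (v' <= u)%MM & (mdeg v' <= mdeg v)%N].
Proof.
move=> gu w0; have [N] := ubnP (max_var v); elim: N v => // N IHN v ltN gv vuw deg_v.
have sfu := stable_min_gen_squarefree gu; have sfv := stable_min_gen_squarefree gv.
have [vu|nvu] := boolP (v <= u)%MM; first by exists v.
have [i vi] : exists i : 'I_n, (u i < v i)%N.
  by apply/existsP; apply: contraR nvu => /existsPn h; apply/mnm_lepP => i; rewrite leqNgt.
have ui : u i = 0%N by have := sfv i; lia.
(* Below [max_var u], an index outside [u] is a gap, where [w] vanishes as well and [v] cannot be
   supported. *)
have mi : (max_var u <= i)%N.
  rewrite leqNgt; apply/negP => lt; have /mnm_lepP/(_ i) := vuw.
  have wi : w i = 0%N by apply: w0; rewrite mem_filter mem_enum lt ui.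
  by rewrite mnmDE ui wi; move: vi; rewrite ui; case: (v i).
have iv : (i < max_var v)%N by apply: ltn_max_var; lia.
have [i0 vi0 i0E] := max_var_witness (leq_trans (ltn0Sn _) iv).
(* Otherwise [u] would divide [v], and the degree bound would force equality. *)
have [j uj vj] : exists2 j, u j != 0%N & v j = 0%N.
  have [/existsP[j /andP[uj /eqP vj]]|/existsPn h] := boolP [exists j, (u j != 0%N) && (v j == 0%N)].
    by exists j.
  have uv : (u <= v)%MM.
    apply/mnm_lepP => j; have := h j; have := sfu j; lia.
  by have := lem_mdeg_eq uv deg_v; move=> E; rewrite E ltnn in vi.
have ju := ltn_max_var uj.
have ji0 : (j < i0)%N by lia.
have [_ _ /(_ v gv i0 j i0E ji0 vj) Iv'] := stI.
have [v2 gv2 v2le] := stable_min_gen_below Iv'.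
have v'E l : (v - U_(i0) + U_(j))%MM l = (v l - (i0 == l) + (j == l))%N.
  by rewrite mnmDE mnmBE !mnm1E.
have deg2 : (mdeg v2 <= mdeg v)%N.
  apply: leq_trans (lem_mdeg v2le) _; rewrite mdegD mdeg1.
  have i0v : (U_(i0) <= v)%MM by rewrite lep1mP.
  by rewrite -{2}(submK i0v) mdegD mdeg1.
(* The exchange removed the last variable of [v] for an earlier one, so [max_var] dropped and
   induction applies. *)
have [|||v3 [g3 le3 deg3]] := IHN v2 _ gv2.
- rewrite ltnS in ltN; apply: leq_trans ltN; rewrite -i0E ltnS; apply: max_var_leq => l v2l.
  have /mnm_lepP/(_ l) := v2le; rewrite v'E.
  case: (i0 =P l) v2l => [<-|ne] v2l.
    by have := sfv i0; case: (j =P i0) => [E|_]; [rewrite E ltnn in ji0 | lia].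
  case: (j =P l) => [<- //|_] le.
  have : (l < max_var v)%N by apply: ltn_max_var; lia.
  by rewrite -i0E ltnS leq_eqVlt => /orP[/eqP/val_inj E|//]; rewrite E in ne.
- apply: lepm_trans v2le _; apply/mnm_lepP => l; rewrite v'E mnmDE.
  have /mnm_lepP/(_ l) := vuw; rewrite mnmDE.
  by case: (j =P l) => [<-|_]; lia.
- exact: leq_trans deg_v.
by exists v3; split=> //; apply: leq_trans deg2.
Qed.

(** The descent ends at a generator dividing [u], hence at [u] itself, which forces equal degrees.
    If [v] did not reach beyond [max_var u], its variables outside [u] would be gaps, where [w]
    vanishes, and [v] would divide [u]. *)
Lemma stable_colon_degree u w v :
  min_gen I u -> (forall l, l \in gap_vars u -> w l = 0%N) ->
  min_gen I v -> (v <= u + w)%MM -> (mdeg v <= mdeg u)%N -> v <> u ->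
  mdeg v = mdeg u /\ (max_var u < max_var v)%N.
Proof.
move=> gu w0 gv vuw deg_v vu.
have [v' [gv' v'u deg_v']] := stable_descent gu w0 gv vuw deg_v.
have E := stable_min_gen_antichain gu gv' v'u; rewrite E in deg_v'.
split; first by apply/eqP; rewrite eqn_leq deg_v.
rewrite ltnNge; apply/negP => le; apply: vu; apply: (stable_min_gen_antichain gu gv).
apply/mnm_lepP => i; rewrite leqNgt; apply/negP => lt.
have sfv := stable_min_gen_squarefree gv i.
have ui : u i = 0%N by lia.
have iv : (i < max_var v)%N by apply: ltn_max_var; lia.
have wi : w i = 0%N by apply: w0; rewrite mem_filter mem_enum ui (leq_trans iv le).
have /mnm_lepP/(_ i) := vuw; rewrite mnmDE wi; lia.
Qed.

(** The exchange of the last variable of [u] for ['X_l] lies in [I]; any minimal generator below it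
    will do. *)
Lemma stable_colon_gap u l : min_gen I u -> l \in gap_vars u ->
  exists v, [/\ min_gen I v, (v <= u + U_(l))%MM, (mdeg v <= mdeg u)%N
              & (max_var v < max_var u)%N].
Proof.
move=> gu; rewrite mem_filter => /andP[/andP[lu /eqP ul] _].
have sfu := stable_min_gen_squarefree gu.
have [i ui iE] := max_var_witness (leq_trans (ltn0Sn _) lu).
have li : (l < i)%N.
  have : (l < i.+1)%N by rewrite iE.
  rewrite ltnS leq_eqVlt => /orP[/eqP/val_inj E|//].
  by rewrite -E ul in ui.
have [_ _ /(_ u gu i l iE li ul) Iv] := stI.
have [v gv vle] := stable_min_gen_below Iv.
have v'E t : (u - U_(i) + U_(l))%MM t = (u t - (i == t) + (l == t))%N.
  by rewrite mnmDE mnmBE !mnm1E.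
exists v; split=> //.
- apply: lepm_trans vle _; apply/mnm_lepP => t; rewrite v'E mnmDE mnm1E; lia.
- apply: leq_trans (lem_mdeg vle) _; rewrite mdegD mdeg1.
  have iu : (U_(i) <= u)%MM by rewrite lep1mP.
  by rewrite -{2}(submK iu) mdegD mdeg1.
rewrite -iE ltnS; apply: max_var_leq => t vt.
have /mnm_lepP/(_ t) := vle; rewrite v'E.
case: (i =P t) vt => [<-|ne] vt.
  by have := sfu i; case: (l =P i) => [E|_]; [rewrite E ltnn in li | lia].
case: (l =P t) => [<- //|_] le.
have : (t < max_var u)%N by apply: ltn_max_var; lia.
by rewrite -iE ltnS leq_eqVlt => /orP[/eqP/val_inj E|//]; rewrite E in ne.
Qed.

End StableIdeal.
End MonomialIdeals.

(** * Betti numbers of squarefree stable submodules *)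

Lemma finite_support_enum (T : eqType) (P : T -> Prop) (s : seq T) :
  (forall x, P x -> x \in s) -> exists gs, uniq gs /\ forall x, x \in gs <-> P x.
Proof.
move=> Ps; pose p x := if excluded_middle_informative (P x) then true else false.
have pP x : p x <-> P x by rewrite /p; case: excluded_middle_informative.
exists (undup (filter p s)); split; first exact: undup_uniq.
move=> x; rewrite mem_undup mem_filter; split=> [/andP[/pP]//|Px].
by rewrite Ps // andbT; apply/pP.
Qed.

Section StableSubmodules.
Variables (K : fieldType) (n r : nat) (I : 'I_r -> {mpoly K[n]} -> Prop).
Hypothesis stI : squarefree_stable_submodule I.
Implicit Types g h : 'I_r * 'X_{1..n}.

Let is_gen g := min_gen (I g.1) g.2.
Let stI1 k : squarefree_stable_ideal (I k).
Proof. by case: stI. Qed.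

(* As max_var is at most n, this orders by degree and then by last variable. *)
Definition gen_key g := mdeg g.2 * n.+1 + max_var g.2.

Lemma gen_key_ltn g h : mdeg h.2 < mdeg g.2 -> gen_key h < gen_key g.
Proof. by have := max_var_le h.2; rewrite /gen_key; nia. Qed.

Lemma gen_key_leq_deg g h : gen_key h <= gen_key g -> mdeg h.2 <= mdeg g.2.
Proof. by apply: contraTT; rewrite -!ltnNge; apply: gen_key_ltn. Qed.

(** The list is decreasing because generators are added from its end. The last hypothesis makes
    every suffix contain all generators of smaller key than its head, so that induction goes
    through. *)
Lemma stable_linear_quotients gs :
  uniq gs -> sorted (fun g h => gen_key h <= gen_key g) gs -> {in gs, forall g, is_gen g} ->
  (forall g h, g \in gs -> is_gen h -> gen_key h < gen_key g -> h \in gs) ->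
  linear_quotients (fun g => gap_vars g.2) gs.
Proof.
elim: gs => //= g gs IHgs /andP[ngs ugs] srt gens closed.
have tr : transitive (fun g h => gen_key h <= gen_key g).
  by move=> h1 h2 h3 le1 le2; apply: leq_trans le1.
have /allP le := order_path_min tr srt.
have gg : is_gen g by apply: gens; rewrite mem_head.
have mem h : is_gen h -> gen_key h < gen_key g -> h \in gs.
  move=> gh lt; have := closed g h (mem_head _ _) gh lt.
  by rewrite inE => /orP[/eqP E|//]; rewrite E ltnn in lt.
split.
- apply: IHgs => //; first exact: path_sorted srt.
    by move=> h hgs; apply: gens; rewrite inE hgs orbT.
  by move=> h h' hgs gh' lt; apply: mem => //; apply: leq_trans lt (le h hgs).
- by move=> h /le; apply: gen_key_leq_deg.
- exact/filter_uniq/enum_uniq.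
move=> w; apply/hasP/hasP => [[h hgs /andP[/eqP h1 h2]]|[l lg wl]].
  (* If [w] avoided the gaps, a divisor [h] would have the degree of [g] and a larger last variable,
     against the order. *)
  have [//|nex] := classic (exists2 l, l \in gap_vars g.2 & w l != 0).
  case/negP: ngs; suff -> : g = h by [].
  apply/eqP; rewrite eq_sym; apply: contraT => ne; exfalso.
  have gh : min_gen (I g.1) h.2 by rewrite -h1; apply: gens; rewrite inE hgs orbT.
  have w0 l : l \in gap_vars g.2 -> w l = 0.
    by move=> lg; apply/eqP; apply: contraT => wl; case: nex; exists l.
  have leh := le h hgs.
  have ne2 : h.2 <> g.2.
    by move=> E; case/eqP: ne; rewrite [h]surjective_pairing [RHS]surjective_pairing h1 E.
  have [Ed lt] := stable_colon_degree (stI1 g.1) gg w0 gh h2 (gen_key_leq_deg leh) ne2.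
  by move: leh; rewrite /gen_key Ed leq_add2l leqNgt lt.
have [v [gv vle vd vm]] := stable_colon_gap (stI1 g.1) gg lg.
exists (g.1, v) => /=.
  by apply: mem => //; rewrite /gen_key /= -addnS leq_add // leq_mul2r vd orbT.
rewrite eqxx; apply: lepm_trans vle _; apply/mnm_lepP => t; rewrite !mnmDE leq_add2l mnm1E.
by case: eqP => [<-|]; rewrite ?lt0n.
Qed.

Lemma stable_gens_enum : exists gs,
  [/\ uniq gs, forall g, g \in gs <-> is_gen g
    & sorted (fun g h => gen_key h <= gen_key g) gs].
Proof.
have [|gs [ugs gsE]] := @finite_support_enum _ is_gen
    (* Squarefree monomials have degree at most [n], which bounds the search. *)
    [seq (k, bmnm b) | k <- enum 'I_r, b <- enum {: 'X_{1..n < n.+1}}].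
  move=> [k u] gu; have /squarefree_mdeg du := stable_min_gen_squarefree (stI1 k) gu.
  apply/allpairsP; exists (k, BMultinom (du : mdeg u < n.+1)) => /=.
  by rewrite !mem_enum.
exists (sort (fun g h => gen_key h <= gen_key g) gs); split.
- by rewrite sort_uniq.
- by move=> g; rewrite mem_sort.
- by apply: sort_sorted => g h; apply: leq_total.
Qed.

Lemma betti_stable : exists gs,
  (forall g, g \in gs <-> is_gen g) /\
  forall i j, betti (direct_sum I) i j =
    \sum_(g <- gs) (mdeg g.2 + i == j) * 'C(size (gap_vars g.2), i).
Proof.
have [gs [ugs gsE srt]] := stable_gens_enum; exists gs; split=> // i j.
apply: (linear_quotients_betti (L := fun g => gap_vars g.2)).
  by apply: stable_linear_quotients => // [g|g h _]; rewrite gsE.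
move=> x; split=> [Ix k w wx|Ux k].
  have /(stable_memP (stI1 k))/(_ w wx)[v gv vw] := Ix k.
  by apply/hasP; exists (k, v); [apply/gsE | rewrite /= eqxx].
apply/(stable_memP (stI1 k)) => w /Ux/hasP[g /gsE gg /andP[/eqP <- gw]].
by exists g.2.
Qed.

(** The summands are natural numbers, so none cancel, and a binomial is nonzero exactly when [i] is
    at most the number of gaps. *)
Lemma betti_stable_neq0 i j : betti (direct_sum I) i j <> 0 <->
  exists k u, [/\ min_gen (I k) u, mdeg u + i = j & i + mdeg u <= max_var u].
Proof.
have [gs [gsE ->]] := betti_stable.
have size_gap g : is_gen g -> (0 < 'C(size (gap_vars g.2), i)) = (i + mdeg g.2 <= max_var g.2).
  move=> gg; rewrite bin_gt0 -(size_gap_vars (stable_min_gen_squarefree (stI1 g.1) gg)).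
  by rewrite leq_add2r.
split=> [nz|[k [u [gu Ej le]]]].
  apply: NNPP => nex; apply: nz; rewrite big_seq big1 // => g /gsE gg.
  have [Ej|//] := eqVneq; rewrite mul1n; apply/eqP; rewrite -leqn0 leqNgt size_gap //.
  by apply/negP => le; apply: nex; exists g.1, g.2.
have gk : (k, u) \in gs by apply/gsE.
rewrite (big_rem _ gk) /= Ej eqxx mul1n => /eqP; rewrite addn_eq0 => /andP[/eqP E _].
by have := size_gap (k, u) gu; rewrite E le.
Qed.

(** * Extremal Betti numbers read off the degree-sequence *)

Section DegreeSequence.
Variables (t : nat) (d m : 'I_t -> nat).
Hypothesis hd : generated_in_degrees I d.
Hypothesis hm : max_var_in_degrees I d m.

(** Ensures that the natural subtractions [m x - d x] are not truncated. *)
Lemma degree_le_max_var x : d x <= m x.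
Proof.
have [[k [u [gu <- <-]]] _] := hm x.
by rewrite -(size_gap_vars (stable_min_gen_squarefree (stI1 k) gu)) leq_addl.
Qed.

Lemma betti_degree_sequence i l : betti (direct_sum I) i (i + l) <> 0 <->
  exists2 x, d x = l & i <= m x - d x.
Proof.
rewrite betti_stable_neq0; split=> [[k [u [gu E le]]]|[x <- le]].
  have ul : mdeg u = l by lia.
  have [_ _ /(_ (mdeg u))[_ [|x xu]]] := hd; first by exists k, u.
  exists x; first by rewrite xu.
  by have [_ /(_ k u gu (esym xu))] := hm x; lia.
have [[k [u [gu ud um]]] _] := hm x.
have := degree_le_max_var x.
by exists k, u; split=> //; lia.
Qed.

Lemma degree_inj x y : d x = d y -> x = y.
Proof.
have [_ inc _] := hd => E; apply/val_inj/eqP; rewrite eqn_leq; apply/andP.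
by split; rewrite leqNgt; apply/negP => /inc; rewrite E ltnn.
Qed.

(** The nonzero Betti numbers fill, for each [x], the segment [i <= m x - d x] at [l = d x]. Its end
    is a corner of the whole region exactly when all later segments are shorter. *)
Lemma extremal_bettiP k kl : extremal_betti (direct_sum I) k kl <->
  exists x, [/\ exceeds_later (fun j => m j - d j) x, k = m x - d x & kl = m x].
Proof.
have [_ inc _] := hd.
split=> [[l [-> /betti_degree_sequence[x dx kx] zero]]|[x [ex -> ->]]].
  (* Extremality restated: no segment has a point weakly beyond [(k, l)] except that point itself.
     Applied to the end of the segment of [x], this gives [k = m x - d x]. *)
  have max i y : k <= i -> d x <= d y -> i <= m y - d y -> i = k /\ y = x.
    move=> ki dxy iy; have [E|ne] := eqVneq (i, d y) (k, l).
      by case: E => -> E; split=> //; apply: degree_inj; rewrite E dx.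
    rewrite dx in dxy; have := zero i (d y) ki dxy; move=> /(_ (elimN eqP ne)) b0.
    by have /betti_degree_sequence : exists2 z, d z = d y & i <= m z - d z by exists y.
  have kE : m x - d x = k by have [-> _] := max _ x kx (leqnn _) (leqnn _).
  exists x; split=> //; last by rewrite -dx -kE subnK ?degree_le_max_var.
  move=> y xy /=; rewrite ltnNge; apply/negP => le; rewrite kE in le.
  by have [_ E] := max k y (leqnn k) (ltnW (inc _ _ xy)) le; rewrite E ltnn in xy.
exists (d x); rewrite subnK ?degree_le_max_var //; split=> //.
  rewrite -{2}(subnK (degree_le_max_var x)); apply/betti_degree_sequence.
  by exists x.
move=> i l ki dl ne; apply: NNPP => /betti_degree_sequence[y dy iy].
have xy : x <= y.
  by rewrite leqNgt; apply/negP => /inc; lia.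
case: (ltnP x y) => [lt|yx]; first by have := ex y lt; rewrite /=; lia.
have E : y = x by apply/val_inj/eqP; rewrite eqn_leq yx.
by apply: ne; rewrite -dy E; rewrite E in iy; congr pair; lia.
Qed.

End DegreeSequence.
End StableSubmodules.

(** * Greedy subsequences *)

Section GreedySubsequences.
Variables (t : nat) (a : 'I_t -> nat).

Lemma exceeds_laterP x : reflect (exceeds_later a x) [forall y : 'I_t, (x < y) ==> (a y < a x)].
Proof.
by apply: (iffP forallP) => h y; [move=> xy; have := h y; rewrite xy | apply/implyP/h].
Qed.

Lemma greedy_subsequence_exists : 0 < t -> exists q (i : 'I_q -> 'I_t), greedy_subsequence a i.
Proof.
case: t a exceeds_laterP => // t' b exP _.
(* The greedy choice amounts to listing all positions that exceed the later ones, in increasing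
   order. *)
pose s := [seq x : 'I_t'.+1 <- enum 'I_t'.+1 | [forall y : 'I_t'.+1, (x < y) ==> (b y < b x)]].
have mem_s x : x \in s <-> exceeds_later b x.
  by rewrite mem_filter mem_enum andbT; split=> /exP.
have srt : sorted (relpre val ltn) s.
  apply: sorted_filter => [x y z|]; first exact: ltn_trans.
  by rewrite -sorted_map val_enum_ord iota_ltn_sorted.
have inc (p p' : 'I_(size s)) : p < p' -> nth ord0 s p < nth ord0 s p'.
  move=> lt; apply: (sorted_ltn_nth _ ord0 srt) => //; rewrite ?inE //.
  by move=> x y z; apply: ltn_trans.
have inc_le (p p' : 'I_(size s)) : p <= p' -> nth ord0 s p <= nth ord0 s p'.
  by rewrite leq_eqVlt => /orP[/eqP/val_inj->//|/inc/ltnW].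
have idx x : exceeds_later b x -> exists p : 'I_(size s), nth ord0 s p = x.
  move/mem_s => xs; have lt : index x s < size s by rewrite index_mem.
  by exists (Ordinal lt); rewrite nth_index.
exists (size s), (fun p => nth ord0 s p); split=> //.
- by move=> p; apply/mem_s/mem_nth.
- move=> p x /idx[p' <-] h; case: (leqP p p') => [/inc_le//|/h].
  by rewrite ltnn.
(* The last position belongs to the list vacuously, so the list is nonempty and ends there. *)
have [|p pE] := idx ord_max; first by move=> y; rewrite ltnNge -ltnS ltn_ord.
have lt : (size s).-1 < size s by rewrite prednK // (leq_ltn_trans _ (ltn_ord p)).
exists (Ordinal lt) => /=; first by rewrite prednK // (leq_ltn_trans _ (ltn_ord p)).
have /inc_le : p <= Ordinal lt by rewrite /= -ltnS prednK // (leq_ltn_trans _ (ltn_ord p)).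
by rewrite pE /= => le; congr _.+1; apply/eqP; rewrite eqn_leq le -ltnS ltn_ord.
Qed.

(** Take the first [p] with [x <= i p], which exists since the subsequence ends at the last
    position. All earlier choices precede [x], so the greedy rule gives [i p <= x]. *)
Lemma greedy_subsequence_onto q (i : 'I_q -> 'I_t) x :
  greedy_subsequence a i -> exceeds_later a x -> exists p, i p = x.
Proof.
move=> [_ _ least [pl _ lastE]] ex.
have xl : x <= i pl by rewrite -ltnS lastE.
case: (@arg_minnP _ pl (fun p => x <= i p) (fun p : 'I_q => p : nat) xl) => p xp min.
exists p; apply/val_inj/eqP; rewrite eqn_leq xp andbT.
apply: least => // p' lt; rewrite ltnNge; apply/negP => /min.
by rewrite leqNgt lt.
Qed.

End GreedySubsequences.

Theorem mainTheorem2 (K : fieldType) (n r : nat)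
    (I : 'I_r -> {mpoly K[n]} -> Prop) (t : nat) (d m : 'I_t -> nat)
    (hr : (1 <= r)%N) (ht : (1 <= t)%N)
    (hI : squarefree_stable_submodule I)
    (hd : generated_in_degrees I d)
    (hm : max_var_in_degrees I d m)
    (hchain : ~ (forall j j' : 'I_t, (j < j')%N -> (m j' - d j' < m j - d j)%N)) :
  (exists q (i : 'I_q -> 'I_t), greedy_subsequence (fun j => m j - d j)%N i) /\
  (forall q (i : 'I_q -> 'I_t), greedy_subsequence (fun j => m j - d j)%N i ->
    [/\ forall p p' : 'I_q, (p < p')%N ->
          (m (i p') - d (i p') < m (i p) - d (i p))%N,
        forall p : 'I_q,
          extremal_betti (direct_sum I) (m (i p) - d (i p))%N (m (i p))
      & exists s : seq (nat * nat),
          [/\ uniq s,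
              forall kl, kl \in s <-> extremal_betti (direct_sum I) kl.1 kl.2
            & size s = q]]).
Proof.
split; first exact: greedy_subsequence_exists.
move=> q i greedy; have [inc exc _ _] := greedy.
have dec (p p' : 'I_q) : p < p' -> m (i p') - d (i p') < m (i p) - d (i p).
  by move/inc; apply: exc.
have extr p : extremal_betti (direct_sum I) (m (i p) - d (i p)) (m (i p)).
  by apply/(extremal_bettiP hI hd hm); exists (i p).
(* The pairs are distinct because their first entries strictly decrease, and exhaustive because the
   greedy choice misses no position. *)
split=> //; exists [seq (m (i p) - d (i p), m (i p)) | p <- enum 'I_q]; split.
- rewrite map_inj_uniq ?enum_uniq // => p p' [E _].
  by case: (ltngtP p p') => [/dec|/dec|/val_inj//]; rewrite E ltnn.
- move=> [k kl]; split=> [/mapP[p _ [-> ->]]|]; first exact: extr.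
  case/(extremal_bettiP hI hd hm) => x [ex /= -> ->].
  have [p <-] := greedy_subsequence_onto greedy ex.
  by apply: map_f; rewrite mem_enum.
- by rewrite size_map size_enum_ord.
Qed.
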